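(* Let $d\ge1$ and $N\ge1$ be integers. For $\alpha\in\mathbb Z_N^{d+1}$ and $1\le n\le N$ define the vector $$\mathsf q_{\alpha,n}=\big(\mathsf Q_{\alpha,n}(\beta;0,N):\ \beta\in\mathbb Z_N^{d+1}\big)\in\mathbb R^{\mathsf n(d,N)},\qquad \mathsf n(d,N)=\binom{N+d}{d},$$ and define $\mathsf q_0=\sqrt{\tfrac{N!}{(d+1)_N}}\,(1,\dots,1)\in\mathbb R^{\mathsf n(d,N)}$. Then the family $\{\mathsf q_0\}\cup\{\mathsf q_{\alpha,n}:\alpha\in\mathbb Z_N^{d+1},\ n=1,\dots,N\}$, which has $1+N\times\mathsf n(d,N)$ members, is a tight frame of $\mathbb R^{\mathsf n(d,N)}$, that is, with $(\cdot,\cdot)$ the standard Euclidean inner product, $$(x,x)=(x,\mathsf q_0)^2+\sum_{n=1}^N\sum_{\alpha\in\mathbb Z_N^{d+1}}(x,\mathsf q_{\alpha,n})^2\qquad\text{for all }x\in\mathbb R^{\mathsf n(d,N)}.$$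
   Context: Notation: $(a)_n=a(a+1)\cdots(a+n-1)$, $(a)_0=1$; for vectors, $|y|$ is the sum of the components, $\alpha!=\prod_i\alpha_i!$, $(y)_\alpha=\prod_i(y_i)_{\alpha_i}$; $\mathbf 1=(1,\dots,1)$. $\mathbb Z_N^{d+1}=\{\alpha\in\mathbb N_0^{d+1}:|\alpha|=N\}$, a set with $\mathsf n(d,N)$ elements, which (in a fixed order) indexes the coordinates of $\mathbb R^{\mathsf n(d,N)}$. For $\kappa\in\mathbb R^{d+1}$ with all $\kappa_i>-1$: $\langle f,g\rangle_{\mathsf H_{\kappa,N}}=\frac{N!}{(|\kappa|+d+1)_N}\sum_{x\in\mathbb Z_N^{d+1}}f(x)g(x)\frac{(\kappa+\mathbf 1)_x}{x!}$; here $\kappa=0$, for which the weight $\frac{(\mathbf 1)_x}{x!}$ equals $1$. $\Pi_n^d$ is the space of polynomials of total degree at most $n$ in $x_1,\dots,x_d$, regarded as functions on $\mathbb Z_N^{d+1}$ (where $x_{d+1}=N-x_1-\cdots-x_d$); polynomials in $x_1,\dots,x_{d+1}$ are regarded as functions on $\mathbb Z_N^{d+1}$ in the same way. For $0\le n\le N$, $\mathcal V_n^d(\mathsf H_{\kappa,N})$ is the space of $p\in\Pi_n^d$ orthogonal to $\Pi_{n-1}^d$ ($\Pi_{-1}^d=\{0\}$). Let $\mathrm m_\alpha(x)=(-1)^{|\alpha|}(-x)_\alpha$, and for $n\le|\alpha|\le N$ let $\mathsf Q_{\alpha,n}(\cdot;\kappa,N)=\frac1{(\kappa+\mathbf 1)_\alpha}\mathrm{proj}_{\mathcal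 V_n^d(\mathsf H_{\kappa,N})}\mathrm m_\alpha$, with $\mathrm{proj}$ the orthogonal projection of $\Pi_N^d$ onto $\mathcal V_n^d(\mathsf H_{\kappa,N})$. *)

(* Defs.v *)
From mathcomp Require Import all_boot all_order all_algebra.
From mathcomp Require Import boolp classical_sets reals.
From mathcomp Require Import mpoly.

Set Implicit Arguments.
Unset Strict Implicit.
Unset Printing Implicit Defensive.

Import Order.TTheory GRing.Theory Num.Theory.
Local Open Scope ring_scope.

(* The set of alpha in N_0^{d+1} with |alpha| = N.  The bound N.+1 on the degree
   only serves to make the type finite. *)
Definition simplexZ (d N : nat) :=
  {m : 'X_{1..d.+1 < N.+1} | mdeg m == N}.

Definition mnm_of_simplexZ d N (x : simplexZ d N) : 'X_{1..d.+1} :=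
  bmnm (sval x).

Coercion mnm_of_simplexZ : simplexZ >-> multinom.

Definition poch (R : pzSemiRingType) (a : R) (n : nat) : R :=
  \prod_(i < n) (a + i%:R).

Definition mpoch (R : pzSemiRingType) k (y : 'rV[R]_k) (alpha : 'X_{1..k}) : R :=
  \prod_(i < k) poch (y 0 i) (alpha i).

Definition vsize (R : pzSemiRingType) k (y : 'rV[R]_k) : R := \sum_(i < k) y 0 i.

Definition mnm_fact k (alpha : 'X_{1..k}) : nat := \prod_(i < k) (alpha i)`!.

Definition mnm_row (R : pzSemiRingType) k (alpha : 'X_{1..k}) : 'rV[R]_k :=
  \row_i (alpha i)%:R.

Section Hahn.
Variables (R : realType) (d N : nat).
Implicit Types (kappa : 'rV[R]_d.+1) (f g h : {ffun simplexZ d N -> R}).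

Definition hahn_ip kappa f g : R :=
  N`!%:R / poch (vsize kappa + d.+1%:R) N *
  \sum_(x : simplexZ d N)
     f x * g x * (mpoch (kappa + const_mx 1) x / (mnm_fact x)%:R).

(* A polynomial in x_1, ..., x_d, as a function on points of N_0^{d+1}:
   the last coordinate is ignored. *)
Definition mpoly_fun (p : {mpoly R[d]}) : {ffun simplexZ d N -> R} :=
  [ffun x : simplexZ d N =>
     p.@[fun i : 'I_d => (x (widen_ord (leqnSn d) i))%:R]].

(* Polynomial functions of total degree < n (recall that msize is the degree
   plus one, and that msize 0 = 0); thus Pi_n^d is [poly_lt n.+1], Pi_{n-1}^d is
   [poly_lt n], and [poly_lt 0] = {0} is Pi_{-1}^d. *)
Definition poly_lt (n : nat) : set {ffun simplexZ d N -> R} :=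
  [set f | exists2 p : {mpoly R[d]}, (msize p <= n)%N & f = mpoly_fun p].

Definition hahn_space kappa (n : nat) : set {ffun simplexZ d N -> R} :=
  [set f | poly_lt n.+1 f /\ forall g, poly_lt n g -> hahn_ip kappa f g = 0].

(* Orthogonal projection onto [hahn_space kappa n]. The default value 0 of
   [xget] is irrelevant when all kappa_i > -1: the projection then exists and is
   unique. *)
Definition hahn_proj kappa (n : nat) f : {ffun simplexZ d N -> R} :=
  xget 0 [set g | hahn_space kappa n g /\
                  forall h, hahn_space kappa n h -> hahn_ip kappa (f - g) h = 0].

Definition m_fun (alpha : 'X_{1..d.+1}) : {ffun simplexZ d N -> R} :=
  [ffun x : simplexZ d N => (-1) ^+ mdeg alpha * mpoch (- mnm_row R x) alpha].

(* Meant for n <= |alpha| <= N. *)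
Definition hahnQ (alpha : 'X_{1..d.+1}) (n : nat) kappa :
    {ffun simplexZ d N -> R} :=
  [ffun x => (mpoch (kappa + const_mx 1) alpha)^-1 *
             hahn_proj kappa n (m_fun alpha) x].

(* The coordinates of R^{n(d,N)} are indexed by [simplexZ d N], in the order of
   its canonical enumeration. *)
Definition qvec (alpha : simplexZ d N) (n : nat) : 'rV[R]_#|{: simplexZ d N}| :=
  \row_j hahnQ alpha n 0 (enum_val j).

Definition q0vec : 'rV[R]_#|{: simplexZ d N}| :=
  const_mx (Num.sqrt (N`!%:R / poch d.+1%:R N)).

(* The index (n, alpha), with n in {0, ..., N-1}, stands for q_{alpha,n+1}. *)
Definition qfamily (i : option ('I_N * simplexZ d N)) :
    'rV[R]_#|{: simplexZ d N}| :=
  if i is Some (n, alpha) then qvec alpha n.+1 else q0vec.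

End Hahn.

Definition dotv (R : pzSemiRingType) k (u v : 'rV[R]_k) : R :=
  \sum_(j < k) u 0 j * v 0 j.

(* Tight frames are normalised to have frame bound 1. *)
Definition tight_frame (R : pzSemiRingType) k (I : finType) (e : I -> 'rV[R]_k) :=
  forall x : 'rV[R]_k, dotv x x = \sum_(i : I) dotv x (e i) ^+ 2.

(* Main.v *)
Require Import Defs.
From mathcomp Require Import all_boot all_order all_algebra.
From mathcomp Require Import boolp classical_sets reals.
From mathcomp Require Import mpoly.

Set Implicit Arguments.
Unset Strict Implicit.
Unset Printing Implicit Defensive.

Import Order.TTheory GRing.Theory Num.Theory.
Local Open Scope ring_scope.

(* For kappa = 0 and |alpha| = N, the function m_alpha / alpha! is the indicator
   of alpha on the simplex, so q_{alpha,n} is the projection P_n of the indicator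
   of alpha onto V_n, and (x, q_{alpha,n}) = (P_n x)(alpha) since P_n is
   self-adjoint. Summing over alpha gives (P_n x, x). The sum of the P_n x for
   n < k is the projection of x onto the polynomials of degree < k, and every
   function on the simplex is a polynomial of degree at most N, so the (P_n x, x)
   for n <= N add up to (x, x). The n = 0 term is (x, q_0)^2, as V_0 consists of
   the constants. *)

(** * Orthogonal projections for the Euclidean inner product on functions *)

Section OrthogonalProjection.
Variables (R : realType) (T : finType).
Implicit Types (f g h : {ffun T -> R^o}).

(** Values lie in [R^o] so that functions form a vector space over [R], with scaling and
    subspaces. *)
Definition dotf f g : R := \sum_x f x * g x.

Lemma dotfC f g : dotf f g = dotf g f.
Proof. by apply: eq_bigr => x _; rewrite mulrC. Qed.

Lemma dotfDl f g h : dotf (f + g) h = dotf f h + dotf g h.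
Proof. by rewrite -big_split; apply: eq_bigr => x _; rewrite ffunE mulrDl. Qed.

Lemma dotfZl c f h : dotf (c *: f) h = c * dotf f h.
Proof. by rewrite mulr_sumr; apply: eq_bigr => x _; rewrite ffunE -mulrA. Qed.

Lemma dotfBl f g h : dotf (f - g) h = dotf f h - dotf g h.
Proof. by rewrite -scaleN1r dotfDl dotfZl mulN1r. Qed.

Lemma dot0f h : dotf 0 h = 0.
Proof. by apply: big1 => x _; rewrite ffunE mul0r. Qed.

Lemma dotfDr f g h : dotf h (f + g) = dotf h f + dotf h g.
Proof. by rewrite dotfC dotfDl !(dotfC h). Qed.

Lemma dotfZr c f h : dotf h (c *: f) = c * dotf h f.
Proof. by rewrite dotfC dotfZl (dotfC h). Qed.

Lemma dotf_eq0 f : (dotf f f == 0) = (f == 0).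
Proof.
apply/eqP/eqP => [|->]; last exact: dot0f.
move/eqP; rewrite psumr_eq0 => [/allP f0|x _]; last by rewrite -expr2 sqr_ge0.
apply/ffunP => x; rewrite ffunE; apply/eqP.
by have := f0 x (mem_index_enum x); rewrite -expr2 sqrf_eq0.
Qed.

Definition is_orthoproj (W : set {ffun T -> R^o}) f g :=
  W g /\ forall h, W h -> dotf (f - g) h = 0.

(** Both sides equal [dotf Pf Pg], because [f - Pf] and [g - Pg] are orthogonal to [W]. *)
Lemma orthoproj_sym (W : set {ffun T -> R^o}) f g Pf Pg :
  is_orthoproj W f Pf -> is_orthoproj W g Pg -> dotf Pf g = dotf f Pg.
Proof.
move=> [WPf fP] [WPg gP]; have /eqP := fP _ WPg; have /eqP := gP _ WPf.
by rewrite !dotfBl !subr_eq0 dotfC (dotfC Pg) => /eqP -> /eqP ->.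
Qed.

(* A subspace U of W of maximal dimension among those admitting orthogonal
   projections is all of W: otherwise the component orthogonal to U of some
   element of W could be added to U. *)
Lemma orthoproj_exists (W : set {ffun T -> R^o}) f :
  W 0 -> (forall c g h, W g -> W h -> W (c *: g + h)) ->
  exists g, is_orthoproj W f g.
Proof.
move=> W0 Wlin.
pose good (U : {vspace {ffun T -> R^o}}) := (forall g, g \in U -> W g) /\
  forall f, exists2 g, g \in U & forall h, h \in U -> dotf (f - g) h = 0.
pose P k := `[< exists2 U, good U & \dim U = k >].
have exP : exists k, P k.
  exists 0%N; apply/asboolP; exists 0%VS; last by rewrite dimv0.
  split=> [g|f']; first by rewrite memv0 => /eqP ->.
  exists 0; first exact: mem0v.
  by move=> h; rewrite memv0 => /eqP ->; rewrite dotfC dot0f.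
have ubP k : P k -> (k <= \dim {:{ffun T -> R^o}})%N.
  by case/asboolP => U _ <-; apply: dimvS; apply: subvf.
case: (ex_maxnP exP ubP) => k /asboolP[U [UW projU] dimU] kmax.
suff WU g : W g -> g \in U.
  have [g gU fg] := projU f; exists g; split; first exact: UW.
  by move=> h /WU; apply: fg.
move=> Wg; apply: contrapT => gNU.
have [e eU ge] := projU g; pose v := g - e.
have Wv : W v by rewrite /v addrC -scaleN1r; apply: Wlin => //; apply: UW.
have vNU : v \notin U by apply/negP => /(memvD eU); rewrite addrC subrK.
have v0 : dotf v v != 0.
  by rewrite dotf_eq0; apply: contraNneq vNU => ->; rewrite mem0v.
suff : P (\dim (U + <[v]>)).
  move/kmax; rewrite -dimU leqNgt => /negP; apply.
  rewrite (ltn_leqif (dimv_leqif_sup (addvSl U <[v]>))).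
  by rewrite subv_add subvv.
apply/asboolP; exists (U + <[v]>)%VS => //; split=> [h|f'].
  case/memv_addP => u uU [w /vlineP[c ->] ->]; rewrite addrC.
  by apply: Wlin => //; apply: UW.
have [e' e'U fe'] := projU f'.
(* As [v] is orthogonal to [U], the projection onto the line of [v] is simply added to the one onto
   [U]. *)
exists (e' + (dotf f' v / dotf v v) *: v).
  by rewrite memv_add // memvZ // memv_line.
move=> h /memv_addP[u uU [w /vlineP[c ->] ->]].
rewrite opprD addrA dotfDr dotfZr !(dotfBl (f' - e')) !dotfZl fe' //.
rewrite (ge u) // (dotfBl f') (dotfC e') (ge e') // subr0 divfK //.
by rewrite subrr !mulr0 subr0 addr0.
Qed.

End OrthogonalProjection.

(** * Polynomial functions on the simplex and their degrees *)

Section SimplexPolynomials.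
Variables (R : realType) (d N : nat).
Implicit Types (f g : {ffun simplexZ d N -> R^o}) (x : simplexZ d N).

Lemma sum_simplexZ x : (\sum_i (x : 'X_{1..d.+1}) i)%N = N.
Proof. by rewrite -mdegE; apply/eqP; apply: (valP x). Qed.

Lemma simplexZ_inj (x y : simplexZ d N) :
  (forall i, (x : 'X_{1..d.+1}) i = (y : 'X_{1..d.+1}) i) -> x = y.
Proof. by move=> xy; do 2!apply: val_inj => /=; apply/mnmP. Qed.

Lemma card_simplexZ : #|{: simplexZ d N}| = 'C(N + d, d).
Proof.
rewrite addnC -card_ord_partitions.
(* Coordinates are at most [N], so [inord] loses nothing, and the image of [h] is the set of tuples
   with sum [N] counted by [card_ord_partitions]. *)
pose h x : d.+1.-tuple 'I_N.+1 := [tuple inord ((x : 'X_{1..d.+1}) i) | i < d.+1].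
have xN x i : ((x : 'X_{1..d.+1}) i < N.+1)%N.
  by rewrite ltnS -[leqRHS](sum_simplexZ x) (bigD1 i) //= leq_addr.
have h_inj : injective h.
  move=> x y xy; apply: simplexZ_inj => i.
  have := congr1 (fun t => val (tnth t i)) xy.
  by rewrite !tnth_mktuple /= !inordK.
rewrite -(card_image h_inj); apply: eq_card => t.
rewrite inE big_tuple; apply/codomP/eqP => [[x ->]|tN].
  rewrite -[RHS](sum_simplexZ x); apply: eq_bigr => i _.
  by rewrite tnth_mktuple inordK.
have degt : mdeg [multinom tnth t i : nat | i < d.+1] == N.
  by rewrite mdegE; apply/eqP; rewrite -[RHS]tN; apply: eq_bigr => i _; rewrite mnmE.
have degt' : (mdeg [multinom tnth t i : nat | i < d.+1] < N.+1)%N.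
  by rewrite ltnS (eqP degt).
exists (exist _ (BMultinom degt') degt) => //.
apply/eq_from_tnth => i; rewrite tnth_mktuple; apply: val_inj => /=.
by rewrite inordK mnmE.
Qed.

Lemma poly_lt_lin n c f g :
  poly_lt n f -> poly_lt n g -> poly_lt n (c *: f + g).
Proof.
move=> [p pn ->] [q qn ->]; exists (c *: p + q).
  rewrite (leq_trans (msizeD_le _ _)) // geq_max qn andbT.
  exact: leq_trans (msizeZ_le _ _) pn.
by apply/ffunP => x; rewrite !ffunE mevalD mevalZ.
Qed.

Lemma poly_lt0 n : @poly_lt R d N n 0.
Proof.
by exists 0; [rewrite msize0|apply/ffunP => x; rewrite !ffunE meval0].
Qed.

Lemma poly_lt_leq m n f : (m <= n)%N -> poly_lt m f -> poly_lt n f.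
Proof. by move=> mn [p pm ->]; exists p => //; apply: leq_trans mn. Qed.

Lemma msizeM_bound (p q : {mpoly R[d]}) a b :
  (msize p <= a.+1)%N -> (msize q <= b.+1)%N -> (msize (p * q) <= (a + b).+1)%N.
Proof.
have [->|p0] := eqVneq p 0; first by rewrite mul0r msize0.
have [->|q0] := eqVneq q 0; first by rewrite mulr0 msize0.
move=> pa qb; rewrite msizeM // -subn1 leq_subLR add1n.
by apply: leq_trans (leq_add pa qb) _; rewrite addSn addnS.
Qed.

Lemma msize_prod_bound (I : Type) (r : seq I) (F : I -> {mpoly R[d]}) a :
  (forall i, msize (F i) <= (a i).+1)%N ->
  (msize (\prod_(i <- r) F i) <= (\sum_(i <- r) a i).+1)%N.
Proof.
move=> Fa; elim/big_ind2: _ => [|p m q n pm qn|i _]; last exact: Fa.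
  by rewrite msize1.
exact: msizeM_bound.
Qed.

(* On the simplex the last coordinate is N minus the sum of the others. *)
Definition simplex_coord (i : 'I_d.+1) : {mpoly R[d]} :=
  if unlift ord_max i is Some j then 'X_j else N%:R%:MP - \sum_j 'X_j.

Lemma msize_simplex_coord i : (msize (simplex_coord i) <= 2)%N.
Proof.
rewrite /simplex_coord; case: unlift => [j|]; first by rewrite msizeX mdeg1.
rewrite (leq_trans (msizeD_le _ _)) // geq_max msizeC msizeN.
apply/andP; split; first by case: (_ != _).
elim/big_ind: _ => [|p q p2 q2|j _]; first by rewrite msize0.
  by rewrite (leq_trans (msizeD_le _ _)) // geq_max p2 q2.
by rewrite msizeX mdeg1.
Qed.

Lemma meval_simplex_coord x i :
  (simplex_coord i).@[fun j => ((x : 'X_{1..d.+1}) (widen_ord (leqnSn d) j))%:R]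
  = ((x : 'X_{1..d.+1}) i)%:R.
Proof.
rewrite /simplex_coord; case: unliftP => [j ->|->].
  rewrite mevalXU; congr (_ %:R); congr (_ _); apply: val_inj.
  by rewrite /= /bump leqNgt ltn_ord.
rewrite mevalB mevalC rmorph_sum -[in N%:R](sum_simplexZ x) big_ord_recr /=.
rewrite natrD natr_sum addrC addrA; under [X in - X]eq_bigr do rewrite mevalXU.
by rewrite addNr add0r.
Qed.

Lemma m_fun_poly alpha :
  poly_lt (mdeg alpha).+1 (m_fun R N alpha : {ffun simplexZ d N -> R^o}).
Proof.
(* Distributing the sign over the factors of the Pochhammer products turns each [- x_i + j] into the
   affine factor [x_i - j]. *)
exists (\prod_i \prod_(j < alpha i) (simplex_coord i - j%:R%:MP)).
  rewrite mdegE; apply: msize_prod_bound => i.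
  (* Writing [alpha i] as a sum of ones lets each affine factor contribute degree 1. *)
  rewrite -[X in (_ <= X.+1)%N]mul1n -[X in (_ <= (_ * X).+1)%N]card_ord.
  rewrite mulnC -sum_nat_const; apply: msize_prod_bound => j.
  rewrite (leq_trans (msizeD_le _ _)) // geq_max msize_simplex_coord msizeN.
  by rewrite msizeC; case: (_ != _).
apply/ffunP => x; rewrite !ffunE rmorph_prod mdegE -prodrXr -big_split.
apply: eq_bigr => i _; rewrite /= rmorph_prod /poch -[X in _ ^+ X]card_ord.
rewrite -prodrN; apply: eq_bigr => j _.
by rewrite !mxE opprD opprK /= mevalB mevalC meval_simplex_coord.
Qed.

Lemma poch_opp_nat (a b : nat) :
  (-1) ^+ b * poch (- a%:R : R) b = (a ^_ b)%:R.
Proof.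
elim: b => [|b IHb]; first by rewrite expr0 mul1r /poch big_ord0.
rewrite /poch big_ord_recr -/(poch _ _) exprS mulN1r mulNr mulrA -mulrN IHb.
(* If [a < b], the falling factorial is already 0, so the truncated subtraction [a - b] does no
   harm. *)
rewrite ffactnSr natrM; have [ba|ab] := leqP b a.
  by rewrite natrB // opprD opprK.
by rewrite ffact_small // !mul0r.
Qed.


End SimplexPolynomials.

(** * Projections onto the Hahn spaces for kappa = 0 *)

Section TightFrame.
Variables (R : realType) (d N : nat).
Implicit Types (f g : {ffun simplexZ d N -> R^o}) (alpha x : simplexZ d N).

Lemma poch_fact a n : poch a.+1%:R n * a`!%:R = (n + a)`!%:R :> R.
Proof.
elim: n => [|n IHn]; first by rewrite /poch big_ord0 mul1r.
rewrite /poch big_ord_recr /= -/(poch _ _) mulrAC IHn -natrD -natrM.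
by rewrite [(n.+1 + a)%N]addSn factS mulnC addSn [(a + n)%N]addnC.
Qed.

(** This reciprocal of the number of points makes [q0vec] a unit vector. *)
Lemma fact_div_poch : N`!%:R / poch d.+1%:R N = 'C(N + d, d)%:R^-1 :> R.
Proof.
have fact_neq0 n : n`!%:R != 0 :> R by rewrite pnatr_eq0 -lt0n fact_gt0.
have := poch_fact d N; rewrite -(bin_fact (leq_addl N d)) addnK !natrM.
rewrite [d`!%:R * _]mulrC mulrA => /(mulIf (fact_neq0 _)) ->.
by rewrite invfM mulrCA divff // mulr1.
Qed.

Lemma m_fun_simplex alpha x :
  m_fun R N alpha x = (mnm_fact alpha)%:R * (x == alpha)%:R.
Proof.
rewrite ffunE mdegE -prodrXr -big_split /=.
under eq_bigr do rewrite !mxE poch_opp_nat.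
have [->|x_neq] := eqVneq x alpha.
  by rewrite mulr1 natr_prod; apply: eq_bigr => i _; rewrite ffactnn.
(* Otherwise [alpha] is below [x] in every coordinate, and equal sums force [x = alpha]. At such an
   [i] the falling factorial vanishes. *)
have [i xa] : exists i, ((x : 'X_{1..d.+1}) i < (alpha : 'X_{1..d.+1}) i)%N.
  apply: contrapT => noi; move/eqP: x_neq; apply; apply: simplexZ_inj => i.
  have ax j : ((alpha : 'X_{1..d.+1}) j <= (x : 'X_{1..d.+1}) j
      ?= iff ((alpha : 'X_{1..d.+1}) j == (x : 'X_{1..d.+1}) j))%N.
    by split=> //; rewrite leqNgt; apply/negP => xj; apply: noi; exists j.
  have [_] := leqif_sum (fun j (_ : xpredT j) => ax j).
  by rewrite !sum_simplexZ eqxx => /esym/forallP/(_ i)/eqP.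
by rewrite (bigD1 i) //= ffact_small // mul0r mulr0.
Qed.

Lemma mpoch_one alpha : mpoch (0 + const_mx 1) alpha = (mnm_fact alpha)%:R :> R.
Proof.
rewrite natr_prod; apply: eq_bigr => i _; rewrite !mxE add0r -[(1 : R)]/(1%:R).
by rewrite -[poch _ _]mulr1 -[in LHS](fact0) poch_fact addn0.
Qed.

Lemma mnm_fact_neq0 k (a : 'X_{1..k}) : (mnm_fact a)%:R != 0 :> R.
Proof.
by rewrite natr_prod; apply/prodf_neq0 => i _; rewrite pnatr_eq0 -lt0n fact_gt0.
Qed.

(** The indicators of points, which span all functions, are multiples of the [m_fun R N a], of
    degree at most [N]. *)
Lemma poly_lt_full f : poly_lt N.+1 f.
Proof.
have -> : f = \sum_(a : simplexZ d N)
    (f a / (mnm_fact a)%:R) *: (m_fun R N a : {ffun simplexZ d N -> R^o}).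
  apply/ffunP => x; rewrite sum_ffunE (bigD1 x) //= ffunE m_fun_simplex eqxx.
  rewrite mulr1 [_ *: _]divfK ?mnm_fact_neq0 // big1 ?addr0 // => a ax.
  by rewrite ffunE m_fun_simplex eq_sym (negPf ax) mulr0 scaler0.
elim/big_rec: _ => [|alpha g _ gN]; first exact: poly_lt0.
apply: poly_lt_lin => //; have := m_fun_poly R N (alpha : simplexZ d N).
by rewrite mdegE sum_simplexZ.
Qed.

Lemma hahn_ip0 f g : hahn_ip 0 f g = 'C(N + d, d)%:R^-1 * dotf f g.
Proof.
rewrite /hahn_ip /vsize big1 => [|i _]; last by rewrite mxE.
rewrite add0r fact_div_poch; congr (_ * _); apply: eq_bigr => x _.
by rewrite mpoch_one divff ?mulr1 // mnm_fact_neq0.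
Qed.

(** Transfers orthogonality to [dotf], to which the projection lemmas apply. *)
Lemma hahn_ip0_eq0 f g : hahn_ip 0 f g = 0 <-> dotf f g = 0.
Proof.
rewrite hahn_ip0; split=> [/eqP|->]; last by rewrite mulr0.
rewrite mulf_eq0 invr_eq0 pnatr_eq0 -leqn0 leqNgt bin_gt0 leq_addl.
by move/eqP.
Qed.

Lemma hahn_space_lin n c f g :
  hahn_space 0 n f -> hahn_space 0 n g -> hahn_space 0 n (c *: f + g).
Proof.
move=> [pf of_] [pg og]; split=> [|h ph]; first exact: poly_lt_lin.
apply/hahn_ip0_eq0; rewrite dotfDl dotfZl.
by rewrite !(hahn_ip0_eq0 _ _).1 ?mulr0 ?addr0; auto.
Qed.

Lemma hahn_projP n f : is_orthoproj (hahn_space 0 n) f (hahn_proj 0 n f).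
Proof.
have [|g [Vg fg]] := @orthoproj_exists _ _ (hahn_space 0 n) f _
  (@hahn_space_lin n).
  split=> [|h _]; first exact: poly_lt0.
  by apply/hahn_ip0_eq0; rewrite dot0f.
(* The default value of [xget] is excluded by the existence of [g]. *)
rewrite /hahn_proj; case: xgetP => [p _ [Vp fp]|/(_ g) nog].
  by split=> // h Vh; apply/hahn_ip0_eq0; apply: fp.
by exfalso; apply: nog; split=> // h Vh; apply/hahn_ip0_eq0; apply: fg.
Qed.

Lemma sum_hahn_proj n f :
  is_orthoproj (poly_lt n) f (\sum_(k < n) hahn_proj 0 k f).
Proof.
elim: n => [|n [Sn fSn]].
  rewrite big_ord0; split=> [|h [p]]; first exact: poly_lt0.
  rewrite leqn0 msize_poly_eq0 => /eqP -> ->; rewrite dotfC.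
  suff -> : mpoly_fun N 0 = 0 :> {ffun simplexZ d N -> R^o} by rewrite dot0f.
  by apply/ffunP => x; rewrite !ffunE meval0.
rewrite big_ord_recr /=; set S := \sum_(k < n) _ in Sn fSn *.
have [[Pn Pn_perp] fP] := hahn_projP n f;
set P := hahn_proj 0 n f in Pn Pn_perp fP *.
split=> [|w wn].
  have := @poly_lt_lin _ _ _ n.+1 1 S P; rewrite scale1r; apply=> //.
  exact: poly_lt_leq Sn.
(* Split [w] into its lower-degree projection [e] and [w - e] in the Hahn space: [f - S] and [P] are
   orthogonal to [e], while [f - P] and [S] are orthogonal to [w - e]. *)
have [e [en we]] := orthoproj_exists w (poly_lt0 R d N n) (@poly_lt_lin R d N n).
have Vwe : hahn_space 0 n (w - e).
  split=> [|g gn]; last by apply/hahn_ip0_eq0; apply: we.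
  rewrite addrC -scaleN1r; apply: poly_lt_lin => //.
  exact: poly_lt_leq en.
rewrite -[w](subrK e) dotfDr opprD addrA [in X in _ + X = _]dotfBl.
rewrite fSn // (hahn_ip0_eq0 P e).1 ?subr0 ?addr0; last exact: Pn_perp.
by rewrite addrAC dotfBl fP // sub0r dotfC we // oppr0.
Qed.

(** Symmetry of the projection moves it from [m_fun R N alpha] to [f]; the factor alpha! left by
    evaluation cancels the normalisation of [hahnQ]. *)
Lemma hahn_proj_val n f alpha :
  hahn_proj 0 n f alpha = dotf f (hahnQ N alpha n (0 : 'rV[R]_d.+1)).
Proof.
have -> : hahnQ N alpha n (0 : 'rV[R]_d.+1) = (mnm_fact alpha)%:R^-1 *:
    (hahn_proj 0 n (m_fun R N alpha) : {ffun _ -> R^o}).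
  by apply/ffunP => x; rewrite !ffunE mpoch_one.
rewrite dotfZr -(orthoproj_sym (hahn_projP n f) (hahn_projP n (m_fun R N alpha))).
rewrite /dotf (bigD1 alpha) //= m_fun_simplex eqxx mulr1 big1 => [|x xa].
  by rewrite addr0 mulrCA mulVf ?mulr1 // mnm_fact_neq0.
by rewrite m_fun_simplex (negPf xa) !mulr0.
Qed.

Lemma dotf_sum_hahn_proj f :
  dotf f f = \sum_(n < N.+1) dotf (hahn_proj 0 n f) f.
Proof.
have [_ /(_ _ (poly_lt_full f))/eqP] := sum_hahn_proj N.+1 f.
rewrite dotfBl subr_eq0 => /eqP ->.
by elim/big_rec2: _ => [|n y g _ <-]; rewrite ?dot0f ?dotfDl.
Qed.

Lemma hahn_proj_dotf n f :
  dotf (hahn_proj 0 n f) f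
  = \sum_(alpha : simplexZ d N) dotf f (hahnQ N alpha n (0 : 'rV[R]_d.+1)) ^+ 2.
Proof.
(* Testing [f - Pf] against [Pf] gives [dotf Pf f = dotf Pf Pf], a sum of squared values. *)
have [Vf /(_ _ Vf)/eqP] := hahn_projP n f.
rewrite dotfBl subr_eq0 dotfC => /eqP ->; apply: eq_bigr => alpha _.
by rewrite hahn_proj_val expr2.
Qed.

Lemma hahn_proj0_dotf f :
  dotf (hahn_proj 0 0 f) f = 'C(N + d, d)%:R^-1 * (\sum_x f x) ^+ 2.
Proof.
(* With one summand, the projection goes onto the constants; testing against 1 identifies [c] as the
   mean of [f]. *)
have := sum_hahn_proj 1 f; rewrite big_ord1 => -[[p /msize1_polyC ->]].
set c := p@_0 => -> f_c.
have cE (h : {ffun simplexZ d N -> R^o}) a :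
    dotf (mpoly_fun N a%:MP) h = a * \sum_x h x.
  by rewrite mulr_sumr; apply: eq_bigr => x _; rewrite ffunE mevalC.
have one1 : poly_lt 1 (mpoly_fun N 1%:MP : {ffun simplexZ d N -> R^o}).
  by exists 1%:MP => //; rewrite msize1.
have /eqP := f_c _ one1; rewrite dotfC cE mul1r.
under eq_bigr do rewrite !ffunE mevalC.
rewrite big_split /= sumrN sumr_const card_simplexZ subr_eq0 => /eqP fE.
rewrite cE expr2 [in RHS]mulrA; congr (_ * _).
rewrite fE -[c *+ _]mulr_natl.
by rewrite mulKf // pnatr_eq0 -lt0n bin_gt0 leq_addl.
Qed.

End TightFrame.

(** * Passage to coordinate vectors and the tight frame identity *)

Lemma dotv_enum (R : realType) (T : finType) (x : 'rV[R]_#|{: T}|)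
    (g : {ffun T -> R^o}) :
  dotv x (\row_j g (enum_val j)) = dotf [ffun t => x 0 (enum_rank t)] g.
Proof.
rewrite [RHS](reindex _ (onW_bij _ (@enum_val_bij T))).
by apply: eq_bigr => j _; rewrite !ffunE mxE enum_valK.
Qed.

Theorem theorem5p10 (R : realType) (d N : nat)
    (hd : (1 <= d)%N) (hN : (1 <= N)%N) :
  [/\ #|{: simplexZ d N}| = 'C(N + d, d),
      #|{: option ('I_N * simplexZ d N)}| = (1 + N * 'C(N + d, d))%N,
      tight_frame (@qfamily R d N)
    & forall x : 'rV[R]_#|{: simplexZ d N}|,
        dotv x x = dotv x (q0vec R d N) ^+ 2
          + \sum_(1 <= n < N.+1) \sum_(alpha : simplexZ d N)
              dotv x (qvec R alpha n) ^+ 2].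
Proof.
have frame (x : 'rV[R]_#|{: simplexZ d N}|) : dotv x x =
    dotv x (q0vec R d N) ^+ 2 + \sum_(1 <= n < N.+1)
      \sum_(alpha : simplexZ d N) dotv x (qvec R alpha n) ^+ 2.
  pose f : {ffun simplexZ d N -> R^o} := [ffun t => x 0 (enum_rank t)].
  have -> : dotv x x = dotf f f.
    rewrite -dotv_enum; congr (dotv x _).
    by apply/rowP => j; rewrite mxE ffunE enum_valK.
  have qE alpha n : dotv x (qvec R alpha n) =
    dotf f (hahnQ N (alpha : simplexZ d N) n (0 : 'rV[R]_d.+1))
    by exact: dotv_enum.
  rewrite dotf_sum_hahn_proj big_ord_recl hahn_proj0_dotf; congr (_ + _).
    have -> : q0vec R d N =
        \row_j [ffun=> Num.sqrt (N`!%:R / poch d.+1%:R N)] (enum_val j).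
      by apply/rowP => j; rewrite !mxE ffunE.
    rewrite dotv_enum fact_div_poch dotfC.
    set s := Num.sqrt _; have -> : dotf [ffun=> s] f = s * \sum_t f t.
      by rewrite mulr_sumr; apply: eq_bigr => t _; rewrite ffunE.
    by rewrite exprMn sqr_sqrtr // invr_ge0 ler0n.
  rewrite big_add1 big_mkord; apply: eq_bigr => n _.
  by rewrite hahn_proj_dotf; apply: eq_bigr => alpha _; rewrite qE.
split=> //; first exact: card_simplexZ.
  by rewrite card_option card_prod card_ord card_simplexZ add1n.
move=> x; rewrite frame (bigD1 None) //=; congr (_ + _).
(* The indices other than [None] are the pairs [(n, alpha)], where [n] stands for degree [n.+1]. *)
rewrite (reindex_omap Some id) => [|[i|]] //=.
under [RHS]eq_bigl do rewrite eqxx.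
by rewrite big_add1 big_mkord pair_big; apply: eq_big => -[].
Qed.
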